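(* Let $X$ be a complete toric surface with singularity content $(n,\mathcal{B})$. Then $$K_X^2=12-n-\sum_{\sigma\in\mathcal{B}}A(\sigma),\qquad\text{where}\quad A(\sigma):=k_\sigma+1-\sum_{i=1}^{k_\sigma}d_i^2b_i+2\sum_{i=1}^{k_\sigma-1}d_id_{i+1},$$ and where, for each $\sigma\in\mathcal{B}$, $[b_1,\ldots,b_{k_\sigma}]$ is the Hirzebruch–Jung continued fraction associated to $\sigma$ and $d_1,\ldots,d_{k_\sigma}$ are the corresponding discrepancies.
   Context: Singularity content. Let $N$ be a rank-two lattice and $\Sigma$ the complete fan in $N_{\mathbb{Q}}=N\otimes_{\mathbb{Z}}\mathbb{Q}$ of the toric surface $X$, with two-dimensional cones $C_1,\ldots,C_m$ numbered cyclically. For a cone $C$ with primitive ray generators $u,v$, the width $w$ is the lattice length of $v-u$ and the local index $\ell$ is the lattice height of the segment $uv$ above the origin. If $C$ has singularity type $\frac1r(1,a-1)$ (i.e. $X_C\cong\mathbb{A}^2/\mu_r$ with weights $1,a-1$, $\gcd(r,a-1)=1$; smooth cones have $r=1$), then $w=\gcd(r,a)$ and $\ell=r/\gcd(r,a)$. Write $w=n_C\ell+\rho$ with $n_C,\rho$ integers, $0\leq\rho<\ell$. The residue is $\mathrm{res}(C):=\frac{1}{\rho\ell}\left(1,\frac{\rho a}{w}-1\right)$ if $\rho\neq0$ and $\mathrm{res}(C):=\varnothing$ if $\rho=0$. The singularity content of $X$ is the pair $(n,\mathcal{B})$ with $n:=\sum_{i=1}^m n_{C_i}$ and $\mathcal{B}$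 the cyclically ordered list $\{\mathrm{res}(C_1),\ldots,\mathrm{res}(C_m)\}$ with the empty residues omitted (repetitions retained). Continued fractions. For a cyclic quotient singularity $\sigma=\frac1r(1,a-1)$ with $1\leq a-1<r$ and $\gcd(r,a-1)=1$ (its own $r,a$), let $[b_1,\ldots,b_k]=b_1-\cfrac{1}{b_2-\cfrac{1}{\cdots-\frac{1}{b_k}}}$, with all $b_i\ge2$, be the Hirzebruch–Jung continued fraction expansion of $r/(a-1)$, of length $k=k_\sigma$. Define $\alpha_i,\beta_i\in\mathbb{Z}_{>0}$ by $\alpha_1=\beta_k=1$, $\alpha_i/\alpha_{i-1}:=[b_{i-1},\ldots,b_1]$ for $2\leq i\leq k$, and $\beta_i/\beta_{i+1}:=[b_{i+1},\ldots,b_k]$ for $1\leq i\leq k-1$. Set $d_i:=-1+(\alpha_i+\beta_i)/r$. If $\pi$ is the minimal resolution of $\sigma$ with exceptional curves $E_1,\dots,E_k$, then $E_i^2=-b_i$ and $d_i$ is the discrepancy of $E_i$. *)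

(* Defs.v *)
From HB Require Import structures.
From mathcomp Require Import all_boot all_order all_algebra.
From mathcomp Require Import zify ring.

Set Implicit Arguments.
Unset Strict Implicit.
Unset Printing Implicit Defensive.

Import Order.TTheory GRing.Theory Num.Theory.
Local Open Scope ring_scope.

(** * Complete fans in the lattice N = Z^2 *)

Notation lattice := 'rV[int]_2.

Definition ratv (v : lattice) : 'rV[rat]_2 := map_mx intr v.

Definition det2 (R : comPzRingType) (u v : 'rV[R]_2) : R :=
  u 0 0 * v 0 1 - u 0 1 * v 0 0.

Definition content2 (v : lattice) : nat := gcdn `|v 0 0| `|v 0 1|.

Definition primitive (v : lattice) : bool := content2 v == 1%N.

Definition in_cone (S : seq lattice) (x : 'rV[rat]_2) : Prop :=
  exists2 c : lattice -> rat,
    forall v, 0 <= c v & x = \sum_(v <- S) c v *: ratv v.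

(* The two-dimensional cones are C_i = cone(ray i, ray (i+1)), indices modulo
   nrays, so that they are numbered cyclically; both orientations are allowed.
   Since the C_i are simplicial, their faces are the cones spanned by subsets
   of the generators, and fan_faces says that C_i and C_j meet along a common
   face. *)
Record complete_fan := CompleteFan {
  nrays : nat;
  ray : 'I_nrays -> lattice;
  ray_primitive : forall i, primitive (ray i);
  ray_inj : injective ray;
  fan_dim2 : forall i, det2 (ray i) (ray (ordS i)) != 0;
  fan_faces : forall i j, exists S : seq lattice,
    [/\ {subset S <= [:: ray i; ray (ordS i)]},
        {subset S <= [:: ray j; ray (ordS j)]} &
        forall x, in_cone S x <->
          (in_cone [:: ray i; ray (ordS i)] x /\
           in_cone [:: ray j; ray (ordS j)] x)];
  fan_complete : forall x, exists i, in_cone [:: ray i; ray (ordS i)] x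
}.

(** * Intersection numbers on the toric surface of a complete fan *)

(* The index of Zu + Zv in N. *)
Definition mult (u v : lattice) : rat := `|det2 u v|%:~R.

(* D_i . D_j for the torus-invariant prime divisors D_i, D_j of ray i, ray j.
   Distinct divisors meet only if their rays span a cone C, with intersection
   number 1 / mult C.  The self-intersection is the coefficient in
     ray (i-1) / mult C_(i-1) + ray (i+1) / mult C_i + D_i^2 * ray i = 0,
   which expresses that principal divisors have degree 0 on D_i; see
   div_char_prime below (the absolute value makes the formula independent of
   the orientation of the numbering). *)
Definition prime_intersection (X : complete_fan) (i j : 'I_(nrays X)) : rat :=
  let u := ray (ord_pred i) in let v := ray i in let w := ray (ordS i) in
  if j == i then - (det2 u w)%:~R / (mult u v * (det2 v w)%:~R)
  else if j == ordS i then (mult (ray i) (ray j))^-1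
  else if i == ordS j then (mult (ray j) (ray i))^-1
  else 0.

(* Torus-invariant Weil Q-divisors, D = \sum_i D i * D_i. *)
Definition divisor (X : complete_fan) := 'I_(nrays X) -> rat.

Definition intersection (X : complete_fan) (D E : divisor X) : rat :=
  \sum_i \sum_j D i * E j * prime_intersection i j.

Definition canonical (X : complete_fan) : divisor X := fun _ => -1.
Arguments canonical X _ : clear implicits.

Definition prime_div (X : complete_fan) (i : 'I_(nrays X)) : divisor X :=
  fun j => (j == i)%:R.

(* The divisor of the character of the torus given by m in M = Hom(N, Z). *)
Definition div_char (X : complete_fan) (m : lattice) : divisor X :=
  fun i => (m 0 0 * ray i 0 0 + m 0 1 * ray i 0 1)%:~R.

(** * Singularity types and singularity content *)

(* The cone spanned by u, v is isomorphic, as a cone in a lattice, to the first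
   quadrant in the lattice Z^2 + Z (1, a - 1)/r, with u, v mapped to the
   standard basis vectors in this order. *)
Definition ordered_cone_type (u v : lattice) (r : nat) (a : int) : Prop :=
  [/\ (0 < r)%N, coprimez r%:Z (a - 1) &
      exists2 e : lattice, e *+ r = u + v *~ (a - 1) &
        forall x : lattice, exists i j k : int, x = u *~ i + v *~ j + e *~ k].

Definition cone_type (u v : lattice) (r : nat) (a : int) : Prop :=
  ordered_cone_type u v r a \/ ordered_cone_type v u r a.

Definition width (u v : lattice) : nat := content2 (v - u).

(* The height |<m, u>| = |<m, v>|, where m is a primitive vector of
   M = Hom(N, Z) vanishing on v - u. *)
Definition local_index (u v : lattice) : nat :=
  let w := (width u v)%:Z in
  let m0 := divz ((v - u) 0 1) w in
  let m1 := - divz ((v - u) 0 0) w in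
  absz (m0 * u 0 0 + m1 * u 0 1).

Definition nT (u v : lattice) : nat := (width u v %/ local_index u v)%N.

(* A pair (r, q) stands for the cyclic quotient singularity (1/r)(1, q); the
   second weight is normalised to 0 <= q < r. *)
Definition singularity := (nat * nat)%type.

Definition residue (u v : lattice) (a : int) : option singularity :=
  let w := width u v in
  let l := local_index u v in
  let rho := (w %% l)%N in
  if rho == 0%N then None
  else Some ((rho * l)%N,
             absz (modz (divz (rho%:Z * a) w%:Z - 1) (rho * l)%N%:Z)).

(* Cyclically ordered lists are sequences up to rotation. *)
Definition singularity_content (X : complete_fan) (n : nat)
    (B : seq singularity) : Prop :=
  n = (\sum_(i < nrays X) nT (ray i) (ray (ordS i)))%N /\
  exists (r : 'I_(nrays X) -> nat) (a : 'I_(nrays X) -> int) (s : nat),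
    (forall i, cone_type (ray i) (ray (ordS i)) (r i) (a i)) /\
    B = rot s (pmap (fun i => residue (ray i) (ray (ordS i)) (a i))
                    (enum 'I_(nrays X))).

(** * Hirzebruch-Jung continued fractions and discrepancies *)

(* [b_1, ..., b_k]; the last step relies on 0^-1 = 0. *)
Fixpoint hj_val (b : seq nat) : rat :=
  if b is c :: b' then c%:R - (hj_val b')^-1 else 0.

(* r/q = b - (b q - r)/q with b the ceiling of r/q; the first argument bounds
   the number of steps, and q steps suffice. *)
Fixpoint hj_rec (fuel r q : nat) : seq nat :=
  if fuel is fuel'.+1 then
    if q == 0%N then [::]
    else let b := ((r + q.-1) %/ q)%N in b :: hj_rec fuel' q (b * q - r)
  else [::].

Definition hj (s : singularity) : seq nat := hj_rec s.2 s.1 s.2.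

Section Discrepancies.
Variable s : singularity.
Let b := hj s.
Let k := size b.

(* Indices are shifted by one: alpha i, beta i, discrepancy i are the
   alpha_(i+1), beta_(i+1), d_(i+1) of [b_1, ..., b_k]. *)
Definition alpha (i : nat) : rat :=
  \prod_(0 <= j < i) hj_val (rev (take j.+1 b)).

Definition beta (i : nat) : rat := \prod_(i.+1 <= j < k) hj_val (drop j b).

Definition discrepancy (i : nat) : rat := -1 + (alpha i + beta i) / s.1%:R.

Definition contribution : rat :=
  k%:R + 1 - \sum_(0 <= i < k) discrepancy i ^+ 2 * (nth 0%N b i)%:R
  + 2 * \sum_(0 <= i < k.-1) discrepancy i * discrepancy i.+1.
End Discrepancies.

(** * Consistency of the definitions *)

Lemma hj_rec_correct f r q : (q <= f)%N -> (0 < q < r)%N ->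
  [/\ all (leq 2) (hj_rec f r q) & hj_val (hj_rec f r q) = r%:R / q%:R].
Proof.
elim: f r q => [|f IH] r q; first by case: q.
move=> lef /andP[q0 ltqr] /=; rewrite (gtn_eqF q0).
set b := (_ %/ q)%N.
have qn0 : q%:R != 0 :> rat by rewrite pnatr_eq0 -lt0n.
have b2 : (2 <= b)%N.
  rewrite /b leq_divRL // mul2n -addnn -[X in (_ + X <= _)%N](prednK q0) addnS.
  by rewrite -addSn leq_add2r.
have leb : (r <= b * q)%N.
  by have := ltn_ceil (r + q.-1) q0; rewrite -/b mulSn; lia.
have ltb : (b * q - r < q)%N.
  rewrite ltn_subLR //; apply: leq_ltn_trans (leq_trunc_div _ _) _.
  by rewrite ltn_add2l prednK.
case: (posnP (b * q - r)) => [E|pos].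
  have -> : hj_rec f q (b * q - r) = [::] by rewrite E; case: (f).
  rewrite /= b2 invr0 subr0; split=> //.
  have -> : r = (b * q)%N by apply/eqP; rewrite eqn_leq leb -subn_eq0 E.
  by rewrite natrM mulfK.
have [||h1 h2] := IH q (b * q - r)%N.
- by rewrite -ltnS; apply: leq_trans ltb _.
- by rewrite pos.
rewrite /= b2 h1 h2; split=> //.
rewrite invf_div natrB // natrM; field; exact: qn0.
Qed.

Lemma hj_correct r q : (0 < q < r)%N ->
  [/\ all (leq 2) (hj (r, q)) & hj_val (hj (r, q)) = r%:R / q%:R].
Proof. exact: hj_rec_correct. Qed.

Lemma det2_ratv u v : det2 (ratv u) (ratv v) = (det2 u v)%:~R.
Proof. by rewrite /det2 !mxE rmorphB !rmorphM. Qed.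

Lemma in_cone2E u v (x : 'rV[rat]_2) : det2 u v != 0 -> u != v ->
  in_cone [:: u; v] x <->
  0 <= det2 x (ratv v) / (det2 u v)%:~R /\
  0 <= det2 (ratv u) x / (det2 u v)%:~R.
Proof.
move=> d0 neq; have d0' : (det2 u v)%:~R != 0 :> rat by rewrite intr_eq0.
split=> [[c c0 ->]|[h1 h2]].
  rewrite !big_cons big_nil addr0.
  have -> : det2 (c u *: ratv u + c v *: ratv v) (ratv v) =
            c u * (det2 u v)%:~R.
    by rewrite -det2_ratv /det2 !mxE; ring.
  have -> : det2 (ratv u) (c u *: ratv u + c v *: ratv v) =
            c v * (det2 u v)%:~R.
    by rewrite -det2_ratv /det2 !mxE; ring.
  by rewrite !mulfK.
exists (fun y => if y == u then det2 x (ratv v) / (det2 u v)%:~R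
                 else det2 (ratv u) x / (det2 u v)%:~R).
  by move=> y; case: ifP.
rewrite !big_cons big_nil addr0 eqxx eq_sym (negPf neq).
apply/rowP=> i; move: d0'; rewrite -det2_ratv /det2 !mxE => d0'.
case: i => [[|[|[]]]] // p.
  have -> : Ordinal p = 0 by apply/val_inj.
  by field.
have -> : Ordinal p = 1 by apply/val_inj.
by field.
Qed.

Section FanTheory.
Variable X : complete_fan.
Implicit Types i j : 'I_(nrays X).

Lemma ordS_neq i : ordS i != i.
Proof.
apply/eqP=> E; have := fan_dim2 i.
by rewrite E /det2 mulrC subrr eqxx.
Qed.

Lemma ray_neq i : ray i != ray (ordS i).
Proof. by apply/eqP => /ray_inj/esym/eqP; rewrite (negPf (ordS_neq i)). Qed.

Lemma nrays_ge3 : (2 < nrays X)%N.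
Proof.
case: (fan_complete X (0 : 'rV[rat]_2)) => i0 _.
rewrite ltnNge; apply/negP=> le2.
have ordSS i : ordS (ordS i) = i.
  apply/val_inj => /=; have := ordS_neq i; have := ltn_ord i.
  rewrite -val_eqE /=; move: (i : nat) => k.
  by case: (nrays X) le2 => [|[|[|]]] // _; case: k => [|[|]].
have all2 i : i = i0 \/ i = ordS i0.
  have := ordS_neq i0; have := ltn_ord i; have := ltn_ord i0.
  move: (ordS i0) => j0 lt1 lt2 ne.
  have lt3 := ltn_ord j0.
  have [->|n1] := eqVneq i i0; first by left.
  right; apply/val_inj; move: ne n1; rewrite -!val_eqE /= => ne n1.
  by move/eqP: ne => ne; move/eqP: n1 => n1; lia.
have [i] := fan_complete X (- ratv (ray i0) - ratv (ray (ordS i0))).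
move=> /in_cone2E => /(_ (fan_dim2 i) (ray_neq i)) [].
have d0' : (det2 (ray i) (ray (ordS i)))%:~R != 0 :> rat.
  by rewrite intr_eq0 fan_dim2.
have -> : - ratv (ray i0) - ratv (ray (ordS i0)) =
          - ratv (ray i) - ratv (ray (ordS i)).
  by case: (all2 i) => ->; rewrite ?ordSS // addrC.
have -> : det2 (- ratv (ray i) - ratv (ray (ordS i))) (ratv (ray (ordS i))) =
   - (det2 (ray i) (ray (ordS i)))%:~R by rewrite -det2_ratv /det2 !mxE; ring.
by rewrite mulNr divff // oppr_ge0 ler10.
Qed.

Lemma ordSS_neq i : ordS (ordS i) != i.
Proof.
have m3 := nrays_ge3; have lti := ltn_ord i; rewrite -val_eqE /=.
have [lt1|le1] := ltnP i.+1 (nrays X).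
  rewrite (modn_small lt1); have [lt2|le2] := ltnP i.+2 (nrays X).
    by rewrite modn_small // gtn_eqF.
  have -> : i.+2 = nrays X by lia.
  by rewrite modnn; lia.
have -> : i.+1 = nrays X by lia.
by rewrite modnn modn_small; lia.
Qed.

Lemma det2_pos i :
  0 < det2 (ray i) (ray (ordS i)) *
      det2 (ray (ordS i)) (ray (ordS (ordS i))).
Proof.
set u := ray i; set v := ray (ordS i); set w := ray _.
have d1 : det2 u v != 0 := fan_dim2 i.
have d2 : det2 v w != 0 := fan_dim2 (ordS i).
have uw : u != w by apply/eqP=> /ray_inj/esym/eqP; rewrite (negPf (ordSS_neq i)).
rewrite lt_neqAle eq_sym mulf_neq0 //= leNgt; apply/negP => neg.
have d1' : (det2 u v)%:~R != 0 :> rat by rewrite intr_eq0.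
have d2' : (det2 v w)%:~R != 0 :> rat by rewrite intr_eq0.
pose t : rat := `|(det2 u w)%:~R / (det2 v w)%:~R|.
pose x : 'rV[rat]_2 := ratv u + t *: ratv v.
have [S [S1 S2 SE]] := fan_faces i (ordS i).
have : in_cone S x.
  apply/SE; split; apply/in_cone2E; rewrite ?fan_dim2 ?ray_neq //.
    have -> : det2 x (ratv v) = (det2 u v)%:~R.
      by rewrite -det2_ratv /x /det2 !mxE; ring.
    have -> : det2 (ratv u) x = t * (det2 u v)%:~R.
      by rewrite -det2_ratv /x /det2 !mxE; ring.
    by rewrite mulfK // divff // ler01 /t normr_ge0.
  have -> : det2 x (ratv w) = (det2 u w)%:~R + t * (det2 v w)%:~R.
    by rewrite -!det2_ratv /x /det2 !mxE; ring.
  have -> : det2 (ratv v) x = - (det2 u v)%:~R.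
    by rewrite -!det2_ratv /x /det2 !mxE; ring.
  rewrite mulrDl mulfK //; split.
    by rewrite /t addrC -lerBlDr sub0r -normrN ler_norm.
  have -> : - (det2 u v)%:~R / (det2 v w)%:~R =
            (- (det2 u v * det2 v w))%:~R * (det2 v w)%:~R ^- 2 :> rat.
    by rewrite rmorphN rmorphM /=; field.
  by rewrite mulr_ge0 ?invr_ge0 ?sqr_ge0 // ler0z oppr_ge0 ltW.
case=> c _ xE.
have : det2 (ratv v) x = 0.
  have onlyv s : s \in S -> s = v.
    move=> sS; have := S1 _ sS; have := S2 _ sS.
    rewrite !inE -/u -/v -/w => /orP[/eqP//|/eqP->].
    by rewrite eq_sym (negPf uw) /= => /eqP.
  rewrite xE big_seq (eq_bigr (fun s => c s *: ratv v)); last first.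
    by move=> s /onlyv {1 2 3}->.
  by rewrite -scaler_suml /det2 !mxE; ring.
have -> : det2 (ratv v) x = - (det2 u v)%:~R.
  by rewrite -!det2_ratv /x /det2 !mxE; ring.
by move/eqP; rewrite oppr_eq0 (negPf d1').
Qed.

Lemma prime_intersectionC i j :
  prime_intersection i j = prime_intersection j i.
Proof.
rewrite /prime_intersection [i == j]eq_sym.
have [->//|nij] := eqVneq j i.
have [E|n1] := eqVneq j (ordS i); have [E'|n2] := eqVneq i (ordS j) => //.
by have := ordSS_neq i; rewrite -E -E' eqxx.
Qed.

Lemma intersection_prime i j :
  intersection (prime_div i) (prime_div j) = prime_intersection i j.
Proof.
rewrite /intersection (bigD1 i) //= (bigD1 j) //= /prime_div !eqxx !mul1r.
rewrite big1 ?addr0 => [|k /negPf->]; last by rewrite mul0r.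
rewrite big1 ?addr0 // => k /negPf nk.
by rewrite big1 // => l _; rewrite nk !mul0r.
Qed.

(* Together with symmetry and the values for distinct divisors, this
   characterises the intersection form. *)
Lemma div_char_prime m i : intersection (div_char m) (prime_div i) = 0.
Proof.
have -> : intersection (div_char m) (@prime_div X i) =
    \sum_j div_char m j * prime_intersection i j.
  apply: eq_bigr => j _; rewrite (bigD1 i) //= /prime_div eqxx mulr1.
  rewrite big1 ?addr0 1?prime_intersectionC // => l /negPf->.
  by rewrite mulr0 mul0r.
set p := ord_pred i.
have pS : ordS p = i by rewrite /p ord_predK.
have ni : ordS i != i := ordS_neq i.
have np : p != i by have := ordS_neq p; rewrite pS eq_sym.
have nps : p != ordS i by have := ordSS_neq p; rewrite pS eq_sym.
rewrite (bigD1 i) //= (bigD1 (ordS i)) //= (bigD1 p) /=; last by rewrite np nps.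
rewrite big1 => [|j /andP[/andP[nj njs] njp]]; last first.
  rewrite /prime_intersection (negPf nj) (negPf njs).
  have [E|] := eqVneq i (ordS j); last by rewrite mulr0.
  by case/eqP: njp; rewrite /p E ordSK.
rewrite addr0 /prime_intersection eqxx (negPf ni) eqxx (negPf np) (negPf nps).
rewrite pS eqxx -/p /div_char /mult.
have := det2_pos p; rewrite pS.
have := fan_dim2 p; have := fan_dim2 i; rewrite pS.
set u := ray p; set v := ray i; set w := ray (ordS i) => d2 d1 pos.
have d1' : (det2 u v)%:~R != 0 :> rat by rewrite intr_eq0.
have d2' : (det2 v w)%:~R != 0 :> rat by rewrite intr_eq0.
have [h1|h1] := ltrP 0 (det2 u v).
  have h2 : 0 < det2 v w by rewrite -(pmulr_rgt0 _ h1).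
  rewrite !gtr0_norm //.
  move: d1' d2'; rewrite -!det2_ratv /det2 !mxE !rmorphD !rmorphM /=.
  by move=> d1' d2'; field; rewrite d1' d2'.
have h1' : det2 u v < 0 by rewrite lt_neqAle d1.
have h2 : det2 v w < 0 by rewrite -(nmulr_rgt0 _ h1').
rewrite !ltr0_norm // !rmorphN /=.
move: d1' d2'; rewrite -!det2_ratv /det2 !mxE !rmorphD !rmorphM /=.
by move=> d1' d2'; field; rewrite d1' d2'.
Qed.

End FanTheory.

Lemma primitive_Bezout u : primitive u ->
  exists p q : int, p * u 0 0 + q * u 0 1 = 1.
Proof.
move=> /eqP pu; have [p [q E]] := Bezoutz (u 0 0) (u 0 1).
by exists p, q; rewrite E /gcdz -/(content2 u) pu.
Qed.

Lemma lattice_eq (u v : lattice) : u 0 0 = v 0 0 -> u 0 1 = v 0 1 -> u = v.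
Proof.
move=> h0 h1; apply/rowP; case=> [[|[|[]]]] // p.
  by have -> : Ordinal p = 0 by apply/val_inj.
by have -> : Ordinal p = 1 by apply/val_inj.
Qed.

Lemma mulzE (u : lattice) (k : int) i : (u *~ k) 0 i = u 0 i * k.
Proof. by rewrite -scaler_int mxE mulrC intz. Qed.

Lemma cone_type_exists u v : primitive u -> primitive v -> det2 u v != 0 ->
  exists a : int, cone_type u v `|det2 u v|%N a.
Proof.
move=> /primitive_Bezout[p [q Eu]] /primitive_Bezout[p' [q' Ev]] d0.
pose e1 : lattice := \row_i (if i == 0 then - q else p).
have e10 : e1 0 0 = - q by rewrite mxE.
have e11 : e1 0 1 = p by rewrite mxE.
pose x0 := det2 v e1; pose y := p' * u 0 0 + q' * u 0 1.
pose z := q' * p - p' * q; pose d := det2 u v.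
have yz : y * x0 + z * d = 1.
  rewrite /y /x0 /z /d /det2 e10 e11.
  rewrite [LHS](_ : _ = (p * u 0 0 + q * u 0 1) * (p' * v 0 0 + q' * v 0 1)).
    by rewrite Eu Ev.
  by ring.
pose sg : int := Num.sg d.
have sg2 : sg * sg = 1 by rewrite /sg -expr2 sqr_sg d0.
have dE : (`|d|%N)%:Z = sg * d by rewrite abszE normrEsg.
exists (1 - y); left; split.
- by rewrite absz_gt0.
- rewrite -/d (_ : 1 - y - 1 = - y); last by ring.
  apply/coprimezP; exists (z * sg, - x0) => /=.
  rewrite dE [LHS](_ : _ = y * x0 + sg * sg * (z * d)); last by ring.
  by rewrite sg2 mul1r.
have v0E : v 0 0 = x0 * u 0 0 - d * q.
  by rewrite -[LHS]mul1r -Eu /x0 /d /det2 e10 e11; ring.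
have v1E : v 0 1 = x0 * u 0 1 + d * p.
  by rewrite -[LHS]mul1r -Eu /x0 /d /det2 e10 e11; ring.
have zd : z * d = 1 - y * x0 by rewrite -yz; ring.
exists ((u *~ z - e1 *~ y) *~ sg).
  rewrite -/d pmulrn (_ : 1 - y - 1 = - y); last by ring.
  rewrite dE -mulrzA mulrA sg2 mul1r.
  by apply: lattice_eq; rewrite !(mulzE, mxE) /= ?v0E ?v1E mulrDl -mulrA zd; ring.
move=> x; exists (det2 x e1), (z * det2 u x), (- (sg * x0 * det2 u x)).
rewrite -mulrzA (_ : sg * - (sg * x0 * det2 u x) = - (x0 * det2 u x)); last first.
  by rewrite -[RHS]mul1r -sg2; ring.
have xE i : i \in [:: 0; 1] -> x 0 i = det2 x e1 * u 0 i + det2 u x * e1 0 i.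
  by rewrite !inE => /orP[]/eqP->; rewrite -[LHS]mul1r -Eu /det2 e10 e11; ring.
apply: lattice_eq; rewrite xE // !(mulzE, mxE) /= ?v0E ?v1E.
  rewrite [RHS](_ : _ = u 0 0 * det2 x e1 + det2 u x * - q * (y * x0 + z * d)).
    by rewrite yz; ring.
  by ring.
rewrite [RHS](_ : _ = u 0 1 * det2 x e1 + det2 u x * p * (y * x0 + z * d)).
  by rewrite yz; ring.
by ring.
Qed.

Lemma singularity_content_exists X : exists n B, singularity_content X n B.
Proof.
have H (i : 'I_(nrays X)) : exists a : int, cone_type (ray i) (ray (ordS i))
    `|det2 (ray i) (ray (ordS i))|%N a.
  exact: (cone_type_exists (ray_primitive i) (ray_primitive _) (fan_dim2 i)).
have [a Ha] := fin_all_exists H.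
do 2!eexists; split; first by [].
exists (fun i => `|det2 (ray i) (ray (ordS i))|%N), a, 0%N; split; rewrite ?rot0 //.
Qed.

(* Main.v *)
Require Import Defs.
From mathcomp Require Import all_boot all_order all_algebra.
From mathcomp Require Import zify ring lra.
Import Order.TTheory GRing.Theory Num.Theory.
Local Open Scope ring_scope.

Set Implicit Arguments.
Unset Strict Implicit.
Unset Printing Implicit Defensive.

(** Write det for [det2] and h(u, w) for the number A(sigma) of the singularity
of the cone spanned by primitive vectors u, w with det(u, w) > 0
([cone_contribution]), with h = 1 on smooth cones.  Everything follows from
one property of h ([splits_cone]): if v lies inside the cone of u and w, and
r = det(u, w), m = det(u, v), m' = det(v, w), then
  h(u, v) + h(v, w) = h(u, w) + (r - m - m')^2 / (r m m').
Inserting the ray v replaces K^2 by K^2 + d^2 E^2 = K^2 - (r - m - m')^2 / (r m m'),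
since the new curve E has E^2 = - r / (m m') and discrepancy
d = (m + m') / r - 1.  Thus the property says that K^2 + sum of h is
unchanged by weighted blow-ups, and it gives both halves of the statement.

Why h has this property.  Completing squares along the Hirzebruch-Jung chain
turns the quadratic form in the discrepancies that defines A into a sum with
one term (r_i - 1 - r_(i+1))^2 / (r_i r_(i+1)) for each curve, where the r_i
are the successive remainders ([contribution_squares]).  Hence A satisfies the
recursion [contribution_rec], which is the property for the ray v next to w on
the boundary of the convex hull of the lattice points of the cone.  The
correction terms of four vectors satisfy a cocycle identity
([defect_cocycle]), so that the property for three of the four triples implies
it for the last; a descent on determinants then reaches every triple.

From cones to residues.  For a cone with w = u + W s, where s is primitive and
det(u, s) = l, the property applied to u, w, s gives
  h(u, w) = h(u, s) - h(w, s) + W / l,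
while h(u + k l s, s) = h(u, s) by a shear.  So cutting a cone of width
W = n l + rho along u + n l s splits off exactly n
([ordered_singularity_contribution]): h is the number of primitive T-cones
plus A of the residue.

Noether's formula.  It remains to see that K^2 = 12 - sum of h over the cones
([noether_cycle]).  A choice of a vector e_v with det(v, e_v) = 1 for every
ray v distributes K^2 over the cones ([square_share]).  Fix a ray u0 and, for v
not parallel to u0, take e_v to be a multiple of u0.  In each
half plane bounded by u0 the property makes h + [square_share] the difference
of a function of one ray, [potential].  The two half planes fit together because
h(u0, v) + h(v, - u0) = 6 - 4 / det(u0, v) ([half_plane_contribution]), and a
full turn contributes 6 + 6 = 12.  That the rays turn only once is used in the
form that no cone contains u0 in its interior ([ray_not_interior]). *)

(** * Contributions of continued fractions *)

(** The numerator of [b_1, ..., b_k], as a product of the values of its tails;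
for r/q in lowest terms it is r, and its value on the i-th tail is the i-th
remainder of the division algorithm. *)
Fixpoint hj_numer (b : seq nat) : rat :=
  if b is _ :: b' then hj_val b * hj_numer b' else 1.

Lemma hj_numer_cons c b : hj_numer (c :: b) = hj_val (c :: b) * hj_numer b.
Proof. by []. Qed.

Lemma hj_val_gt1 b : all (leq 2) b -> b != [::] -> 1 < hj_val b.
Proof.
elim: b => // c b IH /= /andP[c2 allb] _.
have c2' : 2 <= c%:R :> rat by rewrite ler_nat.
case: b IH allb => [|c' b] IH allb; first by rewrite /= invr0; lra.
have := IH allb isT; move: (hj_val _) => y y1.
have : y^-1 < 1 by rewrite invf_lt1 //; lra.
lra.
Qed.

Lemma hj_numer_gt0 b : all (leq 2) b -> 0 < hj_numer b.
Proof.
elim: b => // c b IH allb.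
have v1 := hj_val_gt1 allb isT.
by rewrite hj_numer_cons; apply: mulr_gt0; [lra|apply: IH; case/andP: allb].
Qed.

Lemma prod_hj_val_drop (b : seq nat) j :
  \prod_(j <= i < size b) hj_val (drop i b) = hj_numer (drop j b).
Proof.
have [lej|] := leqP (size b) j; first by rewrite big_geq // drop_oversize.
elim: {j}(size b - j)%N {-2}j (erefl (size b - j)%N) => [|d IH] j E ltj.
  by lia.
rewrite big_ltn // [in RHS](drop_nth 0%N ltj).
have [lej|ltj'] := leqP (size b) j.+1.
  by rewrite big_geq // (drop_nth 0%N ltj) [drop j.+1 b]drop_oversize.
by rewrite (IH j.+1) ?(drop_nth 0%N ltj) //; lia.
Qed.

(** If a ray cuts a cone of index r into cones of indices m and m', then this
is - d^2 E^2 for the new curve E of discrepancy d = (m + m') / r - 1 and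
self-intersection - r / (m m'), that is, the drop of K^2. *)
Definition defect (r m m' : rat) : rat := (r - m - m') ^+ 2 / (r * m * m').

Section CompletingTheSquare.
Variable s : singularity.
Let b := hj s.
Hypothesis b_ge2 : all (leq 2) b.
Hypothesis numer_b : hj_numer b = s.1%:R.
Let V i := hj_val (drop i b).
Let N i := hj_numer (drop i b).

Let all_drop i : all (leq 2) (drop i b).
Proof. by apply/allP=> x /mem_drop; apply/allP. Qed.

Let V_gt0 i : (i < size b)%N -> 0 < V i.
Proof.
move=> lti; apply: lt_trans (hj_val_gt1 (all_drop i) _) => //.
by rewrite -size_eq0 size_drop subn_eq0 -ltnNge.
Qed.

Let N_gt0 i : 0 < N i. Proof. exact: hj_numer_gt0. Qed.

Let N_rec i : (i < size b)%N -> N i = V i * N i.+1.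
Proof. by move=> lti; rewrite /N /V (drop_nth 0%N lti). Qed.

Let V_rec i : (i < size b)%N -> (nth 0%N b i)%:R = V i + (V i.+1)^-1.
Proof. by move=> lti; rewrite /V (drop_nth 0%N lti) /= subrK. Qed.

Let betaE i : beta s i = N i.+1.
Proof. exact: prod_hj_val_drop. Qed.

Let alpha0 : alpha s 0 = 1. Proof. by rewrite /alpha big_geq. Qed.

Let alphaS i : alpha s i.+1 = alpha s i * hj_val (rev (take i.+1 b)).
Proof. by rewrite /alpha big_nat_recr. Qed.

Let alpha1 : (0 < size b)%N -> alpha s 1 = (nth 0%N b 0)%:R.
Proof.
by move=> lt0; rewrite alphaS alpha0 mul1r (take_nth 0%N lt0) take0 /= invr0 subr0.
Qed.

Let alpha_rec i : (i.+1 < size b)%N ->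
  alpha s i.+2 = (nth 0%N b i.+1)%:R * alpha s i.+1 - alpha s i.
Proof.
move=> lti; rewrite alphaS (take_nth 0%N lti) rev_rcons /= alphaS.
have v0 : hj_val (rev (take i.+1 b)) != 0.
  apply/lt0r_neq0; apply: (@lt_trans _ _ 1) => //; apply: hj_val_gt1.
    by rewrite all_rev; apply/allP=> x /mem_take; apply/allP.
  by rewrite -size_eq0 size_rev size_takel // ltnW.
by field.
Qed.

Let N0 : N 0 = s.1%:R. Proof. by rewrite /N drop0. Qed.

(* alpha and beta solve the same linear recurrence of order two, so that their
   Wronskian is constant; it is written with V (i+1) = N (i+1) / N (i+2). *)
Let wronskian i : (i.+1 < size b)%N ->
  alpha s i.+1 * V i.+1 - alpha s i = s.1%:R / N i.+2.
Proof.
elim: i => [|i IH] lti.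
  have lt0 : (0 < size b)%N by lia.
  rewrite alpha0 alpha1 // V_rec // -N0 N_rec // N_rec //.
  have := V_gt0 lti; have := N_gt0 2 => n0 h0.
  by field; rewrite !gt_eqF.
have lti' : (i.+1 < size b)%N by lia.
rewrite alpha_rec // V_rec //.
have := IH lti'; rewrite (@N_rec i.+2) //.
have := V_gt0 lti; have := N_gt0 i.+3 => n0 h0 E.
rewrite [LHS](_ : _ = (alpha s i.+1 * V i.+1 - alpha s i) * V i.+2).
  by rewrite E; field; rewrite !gt_eqF.
by field; rewrite !gt_eqF.
Qed.

(* Completing the square from the first variable on: as b_i = V_i + 1 / V_(i+1),
   the i-th square is V_i (d_i - d_(i-1) / V_i)^2, and what is left over after
   the square of index j is d_j^2 / V_(j+1). *)
Let partial_square j : (j < size b)%N ->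
  \sum_(0 <= i < j.+1) discrepancy s i ^+ 2 * (nth 0%N b i)%:R
  - 2 * \sum_(0 <= i < j) discrepancy s i * discrepancy s i.+1
  = \sum_(0 <= i < j.+1) defect (N i) 1 (N i.+1)
    + discrepancy s j ^+ 2 / V j.+1.
Proof.
have r0 : 0 < s.1%:R :> rat by rewrite -N0.
elim: j => [|j IH] ltj.
  rewrite !big_nat1 big_geq // V_rec // /discrepancy alpha0 betaE.
  have E := N_rec ltj.
  have n1 := N_gt0 1; have h0 := V_gt0 ltj.
  rewrite mulr0 subr0 mulrDr; congr (_ + _).
  by rewrite /defect -N0 E; field; rewrite !gt_eqF.
have ltj' : (j < size b)%N by lia.
rewrite big_nat_recr //= [X in _ - 2 * X]big_nat_recr //=.
rewrite [X in _ = X + _]big_nat_recr //=.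
have {}IH := IH ltj'.
have W := wronskian ltj; have h0 := V_gt0 ltj; have n0 := N_gt0 j.+2.
have hb := V_rec ltj; have NE := N_rec ltj.
rewrite hb.
set d := discrepancy s j in IH *; set d' := discrepancy s j.+1.
suff E : d' ^+ 2 * V j.+1 - 2 * (d * d') + d ^+ 2 / V j.+1 =
         defect (N j.+1) 1 (N j.+2).
  rewrite -E; move: IH.
  move: (\sum_(0 <= i < j.+1) _) (\sum_(0 <= i < j) _) (\sum_(_ <= _ < _) _).
  by move=> x y z; lra.
have dE : d' = d / V j.+1 + (1 - N j.+1 + N j.+2) / N j.+1.
  have aE : alpha s j = alpha s j.+1 * V j.+1 - s.1%:R / N j.+2 by rewrite -W; ring.
  rewrite /d /d' /discrepancy !betaE aE NE.
  by field; rewrite !gt_eqF.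
by rewrite dE /defect NE; field; rewrite !gt_eqF.
Qed.

(** The leftover term vanishes at the end of the chain, because the value of
the empty continued fraction is 0 and 0^-1 = 0. *)
Lemma contribution_squares :
  contribution s = (size b)%:R + 1
    - \sum_(0 <= i < size b) defect (N i) 1 (N i.+1).
Proof.
rewrite /contribution -/b; case E: (size b) => [|k].
  by rewrite !big_geq // mulr0 addr0.
have ltk : (k < size b)%N by rewrite E.
have := partial_square ltk; rewrite [V _]/V drop_oversize ?E //= invr0 mulr0.
by move=> H; lra.
Qed.
End CompletingTheSquare.

Lemma ceil_bounds r q : (0 < q)%N ->
  (r <= (r + q.-1) %/ q * q < r + q)%N.
Proof.
move=> q0; have := ltn_ceil (r + q.-1) q0; rewrite mulSn.
have := leq_divM (r + q.-1) q; lia.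
Qed.

Lemma hj_rec_fuel f g r q : (q <= f)%N -> (q <= g)%N ->
  hj_rec f r q = hj_rec g r q.
Proof.
elim: f g r q => [|f IH] g r q lef leg.
  by have -> : q = 0%N by [lia]; case: g leg.
case: g leg => [|g] leg /=; first by have -> : q = 0%N by lia.
case: posnP => // q0; congr (_ :: _).
have := ceil_bounds r q0 => /andP[_ ub].
by apply: IH; lia.
Qed.

Lemma hj_cons r q c : (0 < q)%N -> (r <= c * q < r + q)%N ->
  hj (r, q) = c :: hj (q, c * q - r)%N.
Proof.
move=> q0 bc; rewrite /hj /=.
have cE : c = ((r + q.-1) %/ q)%N.
  have /andP[b1 b2] := ceil_bounds r q0; case/andP: bc => c1 c2.
  apply/eqP; rewrite eqn_leq -ltnS -[X in _ && X]ltnS.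
  by rewrite -(ltn_pmul2r q0) -[X in _ && X](ltn_pmul2r q0) !mulSn; lia.
case: q q0 bc cE => [|q] // q0 bc cE /=; rewrite -cE.
by congr (_ :: _); apply: hj_rec_fuel; lia.
Qed.

Lemma coprime_hj_step r q c : coprime r q -> (r <= c * q)%N ->
  coprime q (c * q - r).
Proof.
move=> /eqP cop le; rewrite /coprime -dvdn1 -cop dvdn_gcd dvdn_gcdl andbT.
by rewrite -(dvdn_addr _ (dvdn_gcdr q (c * q - r))) subnK // dvdn_mull ?dvdn_gcdl.
Qed.

Lemma hj_numerE r q : (q < r)%N -> coprime r q -> hj_numer (hj (r, q)) = r%:R.
Proof.
elim/ltn_ind: q r => q IH r ltqr cop.
have [q0|q0] := posnP q.
  by move: cop; rewrite q0 /coprime gcdn0 => /eqP->.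
have bc := ceil_bounds r q0; set c := (_ %/ q)%N in bc.
rewrite (hj_cons q0 bc) hj_numer_cons -(hj_cons q0 bc).
have [|_ ->] := @hj_correct r q; rewrite ?q0 ?ltqr //.
have lt : (c * q - r < q)%N by lia.
have cop' : coprime q (c * q - r) by apply: coprime_hj_step; case/andP: bc.
by rewrite (IH _ lt _ lt cop') divfK // pnatr_eq0 -lt0n.
Qed.

(** One step of the division algorithm takes the first term off the sum of
squares: geometrically, it cuts off a smooth cone. *)
Lemma contribution_rec r q c : (0 < q < r)%N -> coprime r q ->
  (r <= c * q < r + q)%N ->
  contribution (r, q) =
  1 + contribution (q, c * q - r)%N - defect r%:R 1 q%:R.
Proof.
move=> /andP[q0 ltqr] cop bc; have hc := hj_cons q0 bc.
have lt : (c * q - r < q)%N by lia.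
have cop' : coprime q (c * q - r) by apply: coprime_hj_step; case/andP: bc.
have Nr := hj_numerE ltqr cop; have Nq := hj_numerE lt cop'.
have [|all2 _] := @hj_correct r q; first by rewrite q0.
have all2' : all (leq 2) (hj (q, c * q - r)%N) by move: all2; rewrite hc => /andP[].
rewrite (contribution_squares all2 Nr) (contribution_squares all2' Nq).
rewrite hc in Nr *; rewrite [size (_ :: _)]/= big_nat_recl //.
by rewrite [drop 0 _]/= [drop 1 _]drop1 [behead _]/= Nr Nq -natr1 opprD; ring.
Qed.

Lemma contribution_smooth : contribution (1, 0)%N = 1.
Proof. by rewrite contribution_squares //= big_geq // subr0 add0r. Qed.

(** * Plane determinants and the contribution of a cone *)

Definition vol (u v : lattice) : rat := (det2 u v)%:~R.

Lemma vol_gt0 u v : 0 < det2 u v -> 0 < vol u v.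
Proof. by rewrite /vol ltr0z. Qed.

Lemma plucker (R : comPzRingType) (a b c d : 'rV[R]_2) :
  det2 a c * det2 b d = det2 a b * det2 c d + det2 a d * det2 b c.
Proof. by rewrite /det2; ring. Qed.

Lemma det2C (R : comPzRingType) (u v : 'rV[R]_2) : det2 v u = - det2 u v.
Proof. by rewrite /det2; ring. Qed.

Lemma det2vv (R : comPzRingType) (u : 'rV[R]_2) : det2 u u = 0.
Proof. by rewrite /det2; ring. Qed.

Lemma det2DZl (R : comPzRingType) (a b : R) (u v w : 'rV[R]_2) :
  det2 (a *: u + b *: v) w = a * det2 u w + b * det2 v w.
Proof. by rewrite /det2 !mxE; ring. Qed.

Lemma det2DZr (R : comPzRingType) (a b : R) (u v w : 'rV[R]_2) :
  det2 w (a *: u + b *: v) = a * det2 w u + b * det2 w v.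
Proof. by rewrite /det2 !mxE; ring. Qed.

Definition companion (w : lattice) : lattice :=
  let pq := egcdz (w 0 0) (w 0 1) in
  \row_i (if i == 0 then pq.2 else - pq.1).

Lemma det2_companion w : primitive w -> det2 (companion w) w = 1.
Proof.
move=> /eqP pw; rewrite /det2 /companion !mxE /=.
case: egcdzP => p q E _ /=.
have : gcdz (w 0 0) (w 0 1) = 1 by rewrite /gcdz -/(content2 w) pw.
by rewrite -E => <-; ring.
Qed.

Lemma det2_primitive e w : det2 e w = 1 -> primitive w.
Proof.
rewrite /det2 => E; apply/eqP/eqP.
rewrite -[_ == _]/(coprimez (w 0 0) (w 0 1)); apply/coprimezP.
by exists (- e 0 1, e 0 0); rewrite /= -E; ring.
Qed.

Lemma basis_expand (e w x : lattice) : det2 e w = 1 ->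
  x = det2 x w *: e + det2 e x *: w.
Proof.
move=> E; apply: lattice_eq; rewrite !mxE.
  by rewrite -[LHS]mul1r -E /det2; ring.
by rewrite -[LHS]mul1r -E /det2; ring.
Qed.

(** A of the singularity of the cone: if det(e, w) = 1, then r e = u + q w with
r = det(u, w) and q = det(u, e), so that the cone has type (1/r)(1, q).  Only
q mod r is determined, since e can be changed by multiples of w. *)
Definition cone_contribution (u w : lattice) : rat :=
  contribution (`|det2 u w|%N, `|modz (det2 u (companion w)) (det2 u w)|%N).
Local Notation h := cone_contribution.

Lemma cone_contributionE e u w : det2 e w = 1 ->
  h u w = contribution (`|det2 u w|%N, `|modz (det2 u e) (det2 u w)|%N).
Proof.
move=> E; rewrite /h; congr (contribution (_, absz _)).
have E' := det2_companion (det2_primitive E).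
rewrite (basis_expand (companion w) E) E' det2DZr mul1r addrC.
by rewrite modzMDl.
Qed.

Lemma cone_contribution_smooth u w : det2 u w = 1 -> h u w = 1.
Proof. by move=> E; rewrite /h E modz1 contribution_smooth. Qed.

Lemma coprime_det2 e u w : primitive u -> det2 e w = 1 ->
  coprimez (det2 u w) (det2 u e).
Proof.
move=> pu E; apply/coprimezP; have E' := det2_companion pu.
exists (det2 (companion u) e, det2 w (companion u)) => /=.
have <- : det2 (companion u) (det2 u w *: e + det2 e u *: w) = 1.
  by rewrite -basis_expand.
by rewrite det2DZr [det2 e u]det2C [det2 w _]det2C; ring.
Qed.

(** * Additivity of the contribution *)

(** K^2 plus the sum of the contributions does not change when the cone of u
and w is cut along v. *)
Definition splits (u v w : lattice) : Prop :=
  h u v + h v w = h u w + defect (vol u w) (vol u v) (vol v w).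

(** Put r = det(u, w) and q = det(u, e).  As q < r, the ray e is the one next to
w in the minimal resolution of the cone, so that the equation is
[contribution_rec]: if c is the ceiling of r/q, then f = c e - w completes e to
a basis, and the cone of u and e has type (1/q)(1, c q - r). *)
Lemma splits_near u e w : primitive u -> det2 e w = 1 ->
  0 < det2 u e -> det2 u e < det2 u w -> splits u e w.
Proof.
move=> pu E q0 ltqr.
have cop := coprime_det2 pu E.
rewrite /splits (cone_contribution_smooth E) (cone_contributionE u E).
rewrite modz_small; last by rewrite ltW //= ?gtr0_norm // (lt_trans q0).
have [r rE] : exists r : nat, det2 u w = r by exists `|det2 u w|%N; lia.
have [q qE] : exists q : nat, det2 u e = q by exists `|det2 u e|%N; lia.
have q0' : (0 < q)%N by lia.
have bc := ceil_bounds r q0'; set c := (_ %/ q)%N in bc.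
pose f : lattice := c%:Z *: e + (-1) *: w.
have fE : det2 f e = 1 by rewrite det2DZl det2vv [det2 w e]det2C E; ring.
have uf : det2 u f = (c * q - r)%N%:Z.
  by rewrite det2DZr qE rE -subzn ?PoszM ?mulN1r //; case/andP: bc.
rewrite (cone_contributionE u fE) uf qE rE modz_small; last by lia.
move: cop; rewrite rE qE /= => cop.
rewrite (@contribution_rec r q c) //; last by lia.
rewrite /vol rE qE E /defect /=.
have q0q : 0 < q%:R :> rat by rewrite ltr0n.
have r0q : 0 < r%:R :> rat by rewrite ltr0n; lia.
by field; rewrite !gt_eqF.
Qed.

Lemma splits_smooth u v w : det2 u v = 1 -> det2 v w = 1 -> 0 < det2 u w ->
  splits u v w.
Proof.
move=> E1 E2 M0; have [lt|] := ltP 1 (det2 u w).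
  apply: splits_near; rewrite ?E1 //.
  by apply: (@det2_primitive (-1 *: v + 0 *: v)); rewrite det2DZl det2C E1; ring.
move=> le; have E3 : det2 u w = 1 by lia.
rewrite /splits !cone_contribution_smooth // /vol E1 E2 E3 /defect.
by field.
Qed.

(** Both sides are the drop of K^2 when the rays b and c are inserted in the
cone of a and d, in either order. *)
Lemma defect_cocycle a b c d :
  0 < det2 a b -> 0 < det2 b c -> 0 < det2 c d -> 0 < det2 a c ->
  0 < det2 b d -> 0 < det2 a d ->
  defect (vol a c) (vol a b) (vol b c) + defect (vol a d) (vol a c) (vol c d) =
  defect (vol b d) (vol b c) (vol c d) + defect (vol a d) (vol a b) (vol b d).
Proof.
do 6![move/vol_gt0 => ?].
have P : vol a c * vol b d = vol a b * vol c d + vol a d * vol b c.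
  by rewrite /vol -!rmorphM -rmorphD /= plucker.
have -> : vol a d = (vol a c * vol b d - vol a b * vol c d) / vol b c.
  by rewrite P; field; rewrite gt_eqF.
rewrite /defect; field; rewrite !gt_eqF //.
by rewrite P addrC addKr mulr_gt0.
Qed.

Section Cocycle.
Variables a b c d : lattice.
Hypotheses (ab : 0 < det2 a b) (bc : 0 < det2 b c) (cd : 0 < det2 c d).
Hypotheses (ac : 0 < det2 a c) (bd : 0 < det2 b d) (ad : 0 < det2 a d).

Lemma splits_acd : splits a b c -> splits b c d -> splits a b d -> splits a c d.
Proof.
have := defect_cocycle ab bc cd ac bd ad.
rewrite /splits; move: (defect _ _ _) (defect _ _ _) (defect _ _ _) (defect _ _ _).
by move=> *; lra.
Qed.

Lemma splits_abd : splits a b c -> splits b c d -> splits a c d -> splits a b d.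
Proof.
have := defect_cocycle ab bc cd ac bd ad.
rewrite /splits; move: (defect _ _ _) (defect _ _ _) (defect _ _ _) (defect _ _ _).
by move=> *; lra.
Qed.
End Cocycle.

Lemma primitive_multiple (k : int) u e : u = k *: e -> primitive u -> 0 < k ->
  k = 1.
Proof.
move=> E pu k0; move: (companion u) (det2_companion pu) => x.
have -> : det2 x u = k * det2 x e by rewrite E /det2 !mxE; ring.
by move=> H; have := dvdz_mulr (det2 x e) (dvdzz k); rewrite H dvdz1; lia.
Qed.

(** If det(u, e) > det(u, w), then e' = e - w is closer to u than e, and any two
of e', e, w form a basis.  So induction on det(u, e) applies to u, e', w, and
the cocycle identity for u, e', e, w carries the property over to u, e, w. *)
Lemma splits_adjacent u e w : primitive u -> det2 e w = 1 ->
  0 < det2 u e -> 0 < det2 u w -> splits u e w.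
Proof.
move=> pu; have [n] := ubnP `|det2 u e|%N.
elim: n e => // n IH e ltn E q0 r0.
have [lt|gt|eq] := ltgtP (det2 u e) (det2 u w); first exact: splits_near.
  pose e' : lattice := 1 *: e + (-1) *: w.
  have ue' : det2 u e' = det2 u e - det2 u w by rewrite det2DZr; ring.
  have e'w : det2 e' w = 1 by rewrite det2DZl det2vv E; ring.
  have e'e : det2 e' e = 1 by rewrite det2DZl det2vv [det2 w e]det2C E; ring.
  apply: (@splits_acd u e' e w); rewrite ?ue' ?e'w ?e'e ?E //; first by lia.
  - by apply: splits_near; rewrite ?ue' //; lia.
  - by apply: splits_smooth; rewrite ?e'w.
  - by apply: IH; rewrite ?ue' //; lia.
have r1 : det2 u w = 1.
  apply: (@primitive_multiple _ u (1 *: e + (-1) *: w)) => //.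
  rewrite {1}(basis_expand u E) [det2 e u]det2C eq.
  by rewrite scale1r scaleN1r scalerBr scaleNr.
by apply: splits_smooth; rewrite ?eq ?r1.
Qed.

(** The ray next to w in the minimal resolution is found by reducing det(v, e)
modulo det(v, w). *)
Lemma near_ray v w : primitive v -> primitive w -> 1 < det2 v w ->
  exists e, [/\ primitive e, det2 e w = 1, 0 < det2 v e & det2 v e < det2 v w].
Proof.
move=> pv pw gt1; pose m := det2 v w; pose k := (det2 v (companion w) %/ m)%Z.
have m0 : 0 < m by apply: lt_trans gt1.
pose e : lattice := 1 *: companion w + (- k) *: w; exists e.
have E : det2 e w = 1 by rewrite det2DZl det2_companion // det2vv; ring.
have veE : det2 v e = modz (det2 v (companion w)) m.
  by rewrite det2DZr /modz -/m; ring.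
split=> //.
- apply: (@det2_primitive (-1 *: w + 0 *: w)).
  by rewrite det2DZl [det2 w e]det2C E; ring.
- have ge0 : 0 <= det2 v e by rewrite veE modz_ge0 ?gt_eqF.
  rewrite lt_neqAle ge0 andbT eq_sym; apply/eqP=> E0; have := coprime_det2 pv E.
  by rewrite E0 /coprimez gcdz0 => /eqP; lia.
- by rewrite veE -[X in _ < X]gtr0_norm // ltz_mod // gt_eqF.
Qed.

(** Descent on det(v, w): with e the ray next to w in the cone of v and w, the
triples u, e, w and v, e, w are covered by [splits_adjacent], and
det(v, e) < det(v, w). *)
Theorem splits_cone u v w : primitive u -> primitive v -> primitive w ->
  0 < det2 u v -> 0 < det2 v w -> 0 < det2 u w -> splits u v w.
Proof.
move=> pu pv; have [n] := ubnP `|det2 v w|%N.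
elim: n w => // n IH w ltn pw uv0 vw0 uw0.
have [vw1|vw1] := eqVneq (det2 v w) 1; first exact: splits_adjacent.
have [|e [pe E gt0 ltm]] := near_ray pv pw; first by move/eqP: vw1; lia.
have ue0 : 0 < det2 u e.
  have := plucker u v e w; rewrite E mulr1 => P.
  by rewrite -(pmulr_lgt0 _ vw0) P addr_gt0 // mulr_gt0.
apply: (@splits_abd u v e w); rewrite ?E //.
- by apply: IH => //; lia.
- exact: splits_adjacent.
- exact: splits_adjacent.
Qed.

(** * Reflections and shears *)

Definition mirror (v : lattice) : lattice :=
  \row_i (if i == 0 then v 0 1 else v 0 0).

Lemma det2_mirror u v : det2 (mirror u) (mirror v) = det2 v u.
Proof. by rewrite /det2 !mxE /=; ring. Qed.

Lemma mirrorK : involutive mirror.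
Proof. by move=> v; apply: lattice_eq; rewrite !mxE. Qed.

Lemma primitive_mirror v : primitive (mirror v) = primitive v.
Proof. by rewrite /primitive /content2 !mxE /= gcdnC. Qed.

Lemma defectC r m m' : defect r m m' = defect r m' m.
Proof. by rewrite /defect; congr (_ ^+ 2 / _); ring. Qed.

(** The two orders of the generators give types (1/r)(1, q) and (1/r)(1, q')
with q q' = 1 mod r.  Their contributions agree because both sides of the
equation are additive and equal to 1 on smooth cones, which determines them. *)
Lemma cone_contribution_mirror u w : primitive u -> primitive w ->
  0 < det2 u w -> h (mirror w) (mirror u) = h u w.
Proof.
move=> pu; have [n] := ubnP `|det2 u w|%N.
elim: n w => // n IH w ltn pw uw0.
have [uw1|uw1] := eqVneq (det2 u w) 1.
  by rewrite !cone_contribution_smooth ?det2_mirror.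
have [|e [pe E gt0 ltm]] := near_ray pu pw; first by move/eqP: uw1; lia.
have : splits u e w by apply: splits_cone; rewrite ?E.
have : splits (mirror w) (mirror e) (mirror u).
  by apply: splits_cone; rewrite ?primitive_mirror ?det2_mirror ?E.
rewrite /splits IH //; last by lia.
rewrite (cone_contribution_smooth E) (@cone_contribution_smooth (mirror w)) ?det2_mirror //.
by rewrite /vol !det2_mirror E defectC; lra.
Qed.

Lemma cone_contribution_shear (k : int) u s : primitive s ->
  h (u + (k * det2 u s) *: s) s = h u s.
Proof.
move=> ps; have E : det2 (u + (k * det2 u s) *: s) s = det2 u s.
  by rewrite /det2 !mxE; ring.
rewrite /h E; congr (contribution (_, absz _)).
rewrite [det2 (_ + _) _](_ : _ = - k * det2 u s + det2 u (companion s)) ?modzMDl //.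
have C := det2_companion ps.
rewrite [LHS](_ : _ = det2 u (companion s) - k * det2 u s * det2 (companion s) s).
  by rewrite C; ring.
by rewrite /det2 !mxE; ring.
Qed.

(** Additivity for u, w = u + W s and s, where the indices are W l, l and l for
l = det(u, s); the correction term is (l - W l - l)^2 / (l * W l * l) = W / l. *)
Lemma cone_contribution_segment (W : int) u s : primitive u -> primitive s ->
  primitive (u + W *: s) -> 0 < det2 u s -> 0 < W ->
  h u (u + W *: s) = h u s - h (u + W *: s) s + W%:~R / vol u s.
Proof.
move=> pu ps pw l0 W0; set w := u + _ in pw *.
have uw : det2 u w = W * det2 u s by rewrite /w /det2 !mxE; ring.
have ws : det2 w s = det2 u s by rewrite /w /det2 !mxE; ring.
have : splits u w s by apply: splits_cone => //; rewrite ?uw ?ws ?mulr_gt0.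
rewrite /splits /vol uw ws rmorphM /= -/(vol u s) => H.
have l0q := vol_gt0 l0; have W0q : 0 < W%:~R :> rat by rewrite ltr0z.
have D : defect (vol u s) (W%:~R * vol u s) (vol u s) = W%:~R / vol u s.
  by rewrite /defect; field; rewrite !gt_eqF.
by move: H; rewrite D; lra.
Qed.

(** * Singularity content of a cone *)

(** Since u, v and e generate the lattice and all their determinants are
multiples of det(e, v), the latter is 1. *)
Lemma ordered_cone_type_basis u v r a : 0 < det2 u v -> ordered_cone_type u v r a ->
  exists2 e, det2 e v = 1 & det2 u e = a - 1.
Proof.
move=> D0 [r0 _ [e eE gen]].
have Dev : det2 u v = r%:Z * det2 e v.
  have -> : r%:Z * det2 e v = det2 (e *+ r) v.
    by rewrite pmulrn /det2 !mulzE; ring.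
  by rewrite eE /det2 !mxE !mulzE; ring.
have Due : r%:Z * det2 u e = (a - 1) * det2 u v.
  have -> : r%:Z * det2 u e = det2 u (e *+ r).
    by rewrite pmulrn /det2 !mulzE; ring.
  by rewrite eE /det2 !mxE !mulzE; ring.
have r0' : r%:Z != 0 by rewrite eqz_nat -lt0n.
have ueE : det2 u e = (a - 1) * det2 e v.
  by apply: (mulfI r0'); rewrite Due Dev mulrCA.
have ev1 : det2 e v = 1.
  have [i [j [k X]]] := gen (\row_i (i == 0)%:R).
  have [i' [j' [k' Y]]] := gen (\row_i (i == 1)%:R).
  have one : det2 (\row_i (i == 0)%:R : lattice) (\row_i (i == 1)%:R) = 1.
    by rewrite /det2 !mxE /=; ring.
  have : (det2 e v %| 1)%Z.
    apply/dvdzP; exists ((i * j' - j * i') * r%:Z + (i * k' - k * i') * (a - 1) +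
      (k * j' - j * k')).
    rewrite -[LHS]one X Y.
    rewrite [LHS](_ : _ = (i * j' - j * i') * det2 u v + (i * k' - k * i') * det2 u e
      + (k * j' - j * k') * det2 e v).
      by rewrite Dev ueE; ring.
    by rewrite /det2 !(mxE, mulzE); ring.
  rewrite dvdz1 => /eqP; have : 0 < det2 e v; last by lia.
  by rewrite -(@pmulr_rgt0 _ r%:Z) -?Dev // ltz_nat.
by exists e; rewrite ?ueE ?ev1 ?mulr1.
Qed.

Definition width_step (u v : lattice) : lattice :=
  let w := (width u v)%:Z in
  \row_i (if i == 0 then divz ((v - u) 0 0) w else divz ((v - u) 0 1) w).

Lemma width_stepE u v : v = u + (width u v)%:Z *: width_step u v.
Proof.
have d0 : ((width u v)%:Z %| ((v - u) 0 0)%R)%Z by rewrite dvdzE dvdn_gcdl.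
have d1 : ((width u v)%:Z %| ((v - u) 0 1)%R)%Z by rewrite dvdzE dvdn_gcdr.
apply: lattice_eq; rewrite mxE [X in _ + X]mxE [X in _ * X]mxE /= mulrC.
  by rewrite (divzK d0) !mxE addrC subrK.
by rewrite (divzK d1) !mxE addrC subrK.
Qed.

Lemma det2_width_step u v : det2 u v = (width u v)%:Z * det2 u (width_step u v).
Proof.
rewrite {1}[v](width_stepE u); move: (width_step u v) => s.
by rewrite /det2 !mxE; ring.
Qed.

Lemma primitive_width_step u v : (0 < width u v)%N -> primitive (width_step u v).
Proof.
move=> W0; have [p [q E]] := Bezoutz ((v - u) 0 0) ((v - u) 0 1).
apply: (@det2_primitive (\row_i (if i == 0 then q else - p))).
have W0' : (width u v)%:Z != 0 by rewrite eqz_nat -lt0n.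
apply: (mulfI W0'); rewrite mulr1 -[RHS]E.
have := width_stepE u v; set s := width_step u v => vE.
by rewrite [X in X - u]vE /det2 !mxE /=; ring.
Qed.

Lemma local_indexE u v : local_index u v = `|det2 u (width_step u v)|%N.
Proof. by rewrite /local_index /det2 !mxE /=; congr absz; ring. Qed.

(** With W = k l + rho and x = u + k l s, subtract [cone_contribution_segment]
for the cone of x and v from the one for the cone of u and v: as
h(x, s) = h(u, s), the difference is W / l - rho / l = k. *)
Lemma ordered_singularity_contribution u v r a : primitive u -> primitive v ->
  0 < det2 u v -> ordered_cone_type u v r a ->
  (nT u v)%:R + oapp contribution 0 (residue u v a) = h u v.
Proof.
move=> pu pv D0 ct; have [e ev ue] := ordered_cone_type_basis D0 ct.
rewrite /nT /residue local_indexE.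
have DE := det2_width_step u v.
have W0 : (0 < width u v)%N by case: (width u v) DE D0 => // ->; rewrite mul0r.
have ps := primitive_width_step W0.
have vE := width_stepE u v; move: DE vE ps.
set s := width_step u v; set W := width u v in W0 *; move=> DE vE ps.
clearbody s W.
have l0 : 0 < det2 u s by rewrite -(@pmulr_rgt0 _ W%:Z) -?DE // ltz_nat.
have [l lE] : exists l : nat, det2 u s = l by exists `|det2 u s|%N; lia.
rewrite lE absz_nat.
have hv : h u v = h u s - h v s + W%:R / l%:R.
  rewrite {1 2}vE cone_contribution_segment -?vE // ?ltz_nat // /vol lE.
  by rewrite vE.
set k := (W %/ l)%N; set rho := (W %% l)%N.
have WE : W = (k * l + rho)%N := divn_eq W l.
have l0' : (0 < l)%N by lia.
have lq : 0 < l%:R :> rat by rewrite ltr0n.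
pose x : lattice := u + (k%:Z * det2 u s) *: s.
have hx : h x s = h u s := cone_contribution_shear k u ps.
have vx : v = x + rho%:Z *: s.
  rewrite vE /x lE WE PoszD PoszM.
  by apply: lattice_eq; rewrite !mxE; ring.
have [rho0|rho_n0] := eqVneq rho 0%N.
  have vx0 : v = x by rewrite vx rho0 scale0r addr0.
  have hvs : h v s = h u s by rewrite vx0.
  rewrite addr0 hv hvs WE rho0 addn0 natrM mulfK ?gt_eqF //; ring.
have rho_gt0 : (0 < rho)%N by rewrite lt0n.
have xs : det2 x s = l by rewrite -lE /x /det2 !mxE; ring.
have xv : det2 x v = (rho * l)%N.
  by rewrite PoszM -xs vx /det2 !mxE; ring.
have se : W%:Z * det2 s e = - a.
  have : det2 v e = -1 by rewrite det2C ev.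
  by rewrite {1}vE => H; rewrite -[a](subrK 1) -ue -[X in _ + X]opprK -H /det2 !mxE; ring.
(* So the vector e that describes the type (1/r)(1, a - 1) of the cone of u and
   v also describes the type of the cone of x and v, which is the residue. *)
have xe : det2 x e = (rho%:Z * a %/ W)%Z - 1.
  have W0' : W%:Z != 0 by rewrite eqz_nat -lt0n.
  have -> : rho%:Z * a = (- (rho%:Z * det2 s e)) * W%:Z.
    by rewrite -[a]opprK -se; ring.
  rewrite mulzK //.
  rewrite [LHS](_ : _ = det2 u e + k%:Z * l%:Z * det2 s e); last first.
    by rewrite -lE /x /det2 !mxE; ring.
  rewrite ue; suff -> : a = - ((k%:Z * l%:Z + rho%:Z) * det2 s e) by ring.
  by rewrite -[a]opprK -se WE PoszD PoszM.
have px : primitive x.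
  move: (companion u) (det2_companion pu) => g gu.
  apply: (@det2_primitive (1 *: g + (k%:Z * det2 g s) *: s)).
  by rewrite -[RHS]gu /x /det2 !mxE; ring.
have hxv : h x v = h u s - h v s + rho%:R / l%:R.
  rewrite {1}vx cone_contribution_segment -?vx //.
  - by rewrite hx /vol xs.
  - by rewrite xs; lia.
move: hxv; rewrite (cone_contributionE _ ev) xv xe absz_nat => hxv.
rewrite [oapp _ _ _]/= hxv hv WE natrD natrM.
by field; rewrite gt_eqF.
Qed.

(** This expression shows that the local index does not change when u and v are
exchanged or reflected. *)
Lemma local_index_det u v : local_index u v = (`|det2 u v| %/ width u v)%N.
Proof.
rewrite local_indexE [in RHS]det2_width_step abszM absz_nat.
have [W0|W0] := posnP (width u v); last by rewrite mulKn.
by rewrite W0 divn0 /det2 !mxE W0 !divz0 !mulr0.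
Qed.

Lemma content2N v : content2 (- v) = content2 v.
Proof. by rewrite /content2 !mxE !abszN. Qed.

Lemma widthC u v : width u v = width v u.
Proof. by rewrite /width -opprB content2N. Qed.

Lemma local_indexC u v : local_index u v = local_index v u.
Proof. by rewrite !local_index_det [det2 u v]det2C abszN widthC. Qed.

Lemma nTC u v : nT u v = nT v u.
Proof. by rewrite /nT widthC local_indexC. Qed.

Lemma residueC u v a : residue u v a = residue v u a.
Proof. by rewrite /residue widthC local_indexC. Qed.

Lemma width_mirror u v : width (mirror u) (mirror v) = width u v.
Proof. by rewrite /width /content2 !mxE /= gcdnC. Qed.

Lemma local_index_mirror u v :
  local_index (mirror u) (mirror v) = local_index u v.
Proof. by rewrite !local_index_det det2_mirror width_mirror det2C abszN. Qed.

Lemma nT_mirror u v : nT (mirror u) (mirror v) = nT u v.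
Proof. by rewrite /nT width_mirror local_index_mirror. Qed.

Lemma residue_mirror u v a : residue (mirror u) (mirror v) a = residue u v a.
Proof. by rewrite /residue width_mirror local_index_mirror. Qed.

Lemma ordered_cone_type_mirror u v r a :
  ordered_cone_type u v r a -> ordered_cone_type (mirror u) (mirror v) r a.
Proof.
have mD x y : mirror (x + y) = mirror x + mirror y.
  by apply: lattice_eq; rewrite !mxE.
have mM x k : mirror (x *~ k) = mirror x *~ k.
  by apply: lattice_eq; rewrite !(mulzE, mxE).
case=> r0 cop [e eE gen]; split=> //; exists (mirror e).
  by rewrite pmulrn -mM -pmulrn eE mD mM.
move=> x; have [i [j [k xE]]] := gen (mirror x).
by exists i, j, k; rewrite -[x]mirrorK xE !mD !mM.
Qed.

Lemma cone_type_mirror u v r a :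
  cone_type u v r a -> cone_type (mirror u) (mirror v) r a.
Proof. by case=> /ordered_cone_type_mirror; [left|right]. Qed.

Lemma singularity_contribution u v r a : primitive u -> primitive v ->
  0 < det2 u v -> cone_type u v r a ->
  (nT u v)%:R + oapp contribution 0 (residue u v a) = h u v.
Proof.
move=> pu pv D0 []; first exact: ordered_singularity_contribution.
move=> /ordered_cone_type_mirror ct.
rewrite -cone_contribution_mirror // nTC residueC -nT_mirror -residue_mirror.
by apply: ordered_singularity_contribution ct;
  rewrite ?primitive_mirror ?det2_mirror.
Qed.

(** * A potential for the canonical square *)

Lemma primitiveN v : primitive (- v) = primitive v.
Proof. by rewrite /primitive content2N. Qed.

Lemma det2Nr (R : comPzRingType) (u v : 'rV[R]_2) : det2 u (- v) = - det2 u v.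
Proof. by rewrite /det2 !mxE; ring. Qed.

Lemma det2Nl (R : comPzRingType) (u v : 'rV[R]_2) : det2 (- u) v = - det2 u v.
Proof. by rewrite /det2 !mxE; ring. Qed.

(** For v, f in the open half plane to the left of u, additivity for u, v, f and
for v, f, - u shows that h(u, v) + h(v, - u) + 4 / det(u, v) has the same value
at v and at f.  If det(u, f) = 1, then this value is 1 + 1 + 4; a shear of f
puts it to the left of v. *)
Lemma half_plane_contribution u v : primitive u -> primitive v ->
  0 < det2 u v -> h u v + h v (- u) = 6 - 4 / vol u v.
Proof.
move=> pu pv m0; pose f0 := - companion u.
have f0E : det2 u f0 = 1 by rewrite /f0 det2Nr -det2C det2_companion.
pose t := `|det2 v f0| + 1; pose f : lattice := 1 *: f0 + (- t) *: u.
have uf : det2 u f = 1 by rewrite det2DZr f0E det2vv; ring.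
have vf : 0 < det2 v f.
  have -> : det2 v f = det2 v f0 + t * det2 u v.
    by rewrite det2DZr [det2 v u]det2C; ring.
  by rewrite /t; nia.
have pf : primitive f by apply: (@det2_primitive u).
have fu : det2 f (- u) = 1 by rewrite det2Nr -det2C.
have vu : det2 v (- u) = det2 u v by rewrite det2Nr -det2C.
have : splits u v f by apply: splits_cone; rewrite ?uf.
have : splits v f (- u) by apply: splits_cone; rewrite ?primitiveN ?fu ?vu.
rewrite /splits (cone_contribution_smooth uf) (cone_contribution_smooth fu).
rewrite /vol uf fu vu -/(vol u v) -/(vol v f) => E1 E2.
have m0q := vol_gt0 m0; have p0q := vol_gt0 vf.
have D : defect 1 (vol u v) (vol v f) - defect (vol u v) (vol v f) 1 =
  4 - 4 / vol u v by rewrite /defect; field; rewrite !gt_eqF.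
by lra.
Qed.

Section Potential.
Variables u0 f : lattice.
Hypotheses (pu0 : primitive u0) (u0f : det2 u0 f = 1).

Let m v : rat := vol u0 v.
Let x v : rat := vol v f.

Let vol_coord u v : vol u v = x u * m v - x v * m u.
Proof.
have : vol u v * vol u0 f = x u * m v - x v * m u.
  by rewrite /x /m /vol -!rmorphM -rmorphB /=; congr intr; rewrite /det2; ring.
by rewrite [vol u0 f]/vol u0f mulr1.
Qed.

(** det(u, e_v) for a vector e_v with det(v, e_v) = 1: namely
- u0 / det(u0, v), or, if v is u0 or - u0, respectively f or - f. *)
Definition transverse (u v : lattice) : rat :=
  if det2 u0 v == 0 then vol u f * vol v f else vol u0 u / vol u0 v.

Lemma parallel_primitive v : primitive v -> det2 u0 v = 0 -> v = u0 \/ v = - u0.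
Proof.
move=> pv m0; have := basis_expand v u0f.
rewrite m0 scale0r addr0; move: (det2 v f) => k vE.
have [k0|k0|k0] := ltgtP k 0.
- right; have E : v = (- k) *: (- u0) by rewrite scaleNr scalerN opprK.
  by rewrite E (primitive_multiple E) ?scale1r // oppr_gt0.
- by left; rewrite vE (primitive_multiple vE) ?scale1r.
- by move: pv; rewrite vE k0 scale0r /primitive /content2 !mxE.
Qed.

(** Dividing by vol u v * vol v w, the self-intersection of the divisor of the
ray v is distributed over the two cones that contain it. *)
Lemma vol_transverse u v w : primitive v -> 0 < det2 u v -> 0 < det2 v w ->
  vol u w = vol u v * transverse w v + vol v w * transverse u v.
Proof.
move=> pv uv vw; rewrite /transverse.
have [m0|m0] := eqVneq (det2 u0 v) 0.
  have xx : vol v f * vol v f = 1.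
    have [->|->] := parallel_primitive pv m0; rewrite /vol ?det2Nl u0f.
      by rewrite mulr1.
    by rewrite mulrNN mulr1.
  rewrite -[LHS]mulr1 -xx /vol -!rmorphM -!rmorphD /=; congr intr.
  by rewrite /det2; ring.
have m0' : vol u0 v != 0 by rewrite /vol intr_eq0.
apply: (mulIf m0'); rewrite mulrDl -!mulrA !mulVf // !mulr1 /vol -!rmorphM -!rmorphD /=.
by congr intr; rewrite /det2; ring.
Qed.

(** The part of K^2 that belongs to the cone of u and v: the intersection
number 1 / det(u, v) counted twice, and a share of the self-intersections of
both divisors. *)
Definition square_share (u v : lattice) : rat :=
  (2 - transverse v u - transverse u v) / vol u v.

(** The sum of h + [square_share] over the cones met when turning from u0 to v,
in terms of v alone; it is 0 at u0, 6 at - u0, and would be 12 on returning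
to u0. *)
Definition potential (v : lattice) : rat :=
  if 0 < det2 u0 v then h u0 v + (2 - vol v f) / vol u0 v
  else if det2 u0 v < 0 then 12 - h v u0 + (2 - vol v f) / vol u0 v
  else if v == u0 then 0 else 6.

Let potential_u0 : potential u0 = 0.
Proof. by rewrite /potential det2vv ltxx eqxx. Qed.

Let neq_opp : - u0 != u0.
Proof.
apply/eqP=> E; have := u0f; rewrite -{1}E det2Nl u0f; lia.
Qed.

Let potential_Nu0 : potential (- u0) = 6.
Proof. by rewrite /potential det2Nr det2vv oppr0 ltxx (negPf neq_opp). Qed.

(** The excluded case is that of a cone with u0 in its interior.  If u and v are
on the same side of u0, then the step is additivity for u0, u, v or for
u, v, u0; if - u0 lies between them, then it is additivity for u, - u0, v
together with [half_plane_contribution]. *)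
Lemma potential_step u v : primitive u -> primitive v -> 0 < det2 u v ->
  ~~ ((det2 u0 u < 0) && (0 < det2 u0 v)) ->
  h u v + square_share u v = potential v - potential u + 12 * (v == u0)%:R.
Proof.
move=> pu pv uv nc; have p0 := vol_gt0 uv.
have transverse_u0 w : transverse w u0 = vol w f.
  by rewrite /transverse det2vv eqxx /vol u0f mulr1.
have u0_transverse w : det2 u0 w != 0 -> transverse u0 w = 0.
  by rewrite /transverse => /negPf->; rewrite /vol det2vv mul0r.
have [vu|vu] := eqVneq v u0.
  subst v; have mu : det2 u0 u < 0 by rewrite det2C oppr_lt0.
  rewrite potential_u0 /potential ltNge (ltW mu) mu /square_share.
  rewrite transverse_u0 u0_transverse ?lt_eqF //.
  have -> : vol u u0 = - vol u0 u by rewrite /vol det2C rmorphN.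
  by rewrite invrN mulr1 /=; lra.
rewrite mulr0 addr0.
have [uu|uu] := eqVneq u u0.
  subst u; rewrite potential_u0 /potential uv /square_share.
  rewrite transverse_u0 u0_transverse ?gt_eqF //.
  by rewrite /=; lra.
have [um|um|um] := ltgtP (det2 u0 u) 0; last first.
- have [uE|uE] := parallel_primitive pu um; first by rewrite uE eqxx in uu.
  subst u; have vm : det2 u0 v < 0 by rewrite -oppr_gt0 -det2Nl.
  have := half_plane_contribution pu pv uv; rewrite opprK.
  rewrite potential_Nu0 /potential ltNge (ltW vm) vm /square_share.
  have -> : transverse v (- u0) = - vol v f.
    by rewrite /transverse det2Nr det2vv oppr0 eqxx /vol det2Nl u0f; ring.
  have -> : transverse (- u0) v = 0.
    by rewrite /transverse lt_eqF // /vol det2Nr det2vv oppr0 mul0r.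
  have -> : vol (- u0) v = - vol u0 v by rewrite /vol det2Nl rmorphN.
  by rewrite invrN /=; lra.
- have mu : 0 < m u := vol_gt0 um.
  have [vm|vm|vm] := ltgtP (det2 u0 v) 0; last first.
  + have [vE|vE] := parallel_primitive pv vm; first by rewrite vE eqxx in vu.
    subst v; have := half_plane_contribution pu0 pu um.
    rewrite potential_Nu0 /potential um /square_share.
    have -> : transverse u (- u0) = - vol u f.
      by rewrite /transverse det2Nr det2vv oppr0 eqxx /vol det2Nl u0f; ring.
    have -> : transverse (- u0) u = 0.
      by rewrite /transverse gt_eqF // /vol det2Nr det2vv oppr0 mul0r.
    have -> : vol u (- u0) = vol u0 u by rewrite /vol det2Nr -det2C.
    by rewrite /=; lra.
  + have mv : 0 < m v := vol_gt0 vm.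
    have : splits u0 u v by apply: splits_cone.
    rewrite /splits /potential um vm /square_share /transverse !gt_eqF //.
    rewrite -/(m u) -/(m v) -/(x u) -/(x v) => E.
    suff : defect (m v) (m u) (vol u v) + (2 - m v / m u - m u / m v) / vol u v =
       (2 - x v) / m v - (2 - x u) / m u by lra.
    move: p0; rewrite /defect vol_coord => p0.
    by field; rewrite !gt_eqF.
  + have mv : 0 < - m v by rewrite /m /vol -rmorphN ltr0z oppr_gt0.
    have h1 := half_plane_contribution pu0 pu um.
    have pN : primitive (- u0) by rewrite primitiveN.
    have wv : 0 < det2 (- u0) v by rewrite det2Nl oppr_gt0.
    have uw : 0 < det2 u (- u0) by rewrite det2Nr -det2C.
    have := half_plane_contribution pN pv wv; rewrite opprK => h2.
    have : splits u (- u0) v by apply: splits_cone.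
    rewrite /splits /potential um vm ltNge (ltW vm) /square_share /transverse.
    rewrite (gt_eqF um) (lt_eqF vm) /=.
    move: h1 h2.
    have -> : vol u (- u0) = m u by rewrite /vol det2Nr -det2C.
    have -> : vol (- u0) v = - m v by rewrite /vol det2Nl rmorphN.
    rewrite -/(m u) -/(m v) -/(x u) -/(x v) => h1 h2 E.
    (* The half planes give 6 - 4 / det(u0, u) and 6 - 4 / det(- u0, v). *)
    suff : (12 - 4 / m u - 4 / - m v) - defect (vol u v) (m u) (- m v)
        + (2 - m v / m u - m u / m v) / vol u v =
       12 + (2 - x v) / m v - (2 - x u) / m u by lra.
    have mv0 : m v != 0 by rewrite -oppr_eq0 gt_eqF.
    move: p0; rewrite /defect vol_coord => p0.
    by field; rewrite mv0 !gt_eqF.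
have vm : det2 u0 v < 0.
  rewrite um /= -leNgt in nc; rewrite lt_neqAle nc andbT; apply/eqP=> vm.
  have [vE|vE] := parallel_primitive pv vm; first by rewrite vE eqxx in vu.
  by move: uv; rewrite vE det2Nr -det2C; lia.
have mu : 0 < - m u by rewrite /m /vol -rmorphN ltr0z oppr_gt0.
have mv : 0 < - m v by rewrite /m /vol -rmorphN ltr0z oppr_gt0.
have : splits u v u0 by apply: splits_cone => //; rewrite det2C oppr_gt0.
rewrite /splits /potential um vm !ltNge !ltW //= /square_share /transverse !lt_eqF //.
have volN w : vol w u0 = - m w by rewrite /m /vol det2C rmorphN.
rewrite !volN -/(m u) -/(m v) -/(x u) -/(x v) => E.
suff : defect (- m u) (vol u v) (- m v) + (2 - m v / m u - m u / m v) / vol u v =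
   (2 - x v) / m v - (2 - x u) / m u by lra.
have mv0 : m v != 0 by rewrite -oppr_eq0 gt_eqF.
have mu0 : m u != 0 by rewrite -oppr_eq0 gt_eqF.
move: p0; rewrite /defect vol_coord => p0.
by field; rewrite mv0 mu0 !gt_eqF.
Qed.
End Potential.

(** * Noether's formula *)

(** The rays leave u0 = y i0 and return to it only at the end of one turn, so
that the differences of the potential add up to 0 and the step that returns to
u0 adds 12. *)
Lemma noether_cycle n (y : 'I_n -> lattice) (i0 : 'I_n) :
    (forall i, primitive (y i)) -> injective y ->
    (forall i, 0 < det2 (y i) (y (ordS i))) ->
    (forall i, ~~ ((0 < det2 (y i) (y i0)) && (0 < det2 (y i0) (y (ordS i))))) ->
  \sum_i (2 / vol (y i) (y (ordS i))
    - vol (y (ord_pred i)) (y (ordS i)) /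
      (vol (y (ord_pred i)) (y i) * vol (y i) (y (ordS i)))) =
  12 - \sum_i h (y i) (y (ordS i)).
Proof.
move=> py yi yS nc; set u0 := y i0.
have pu0 : primitive u0 := py i0.
pose f := - companion u0.
have u0f : det2 u0 f = 1 by rewrite /f det2Nr -det2C det2_companion.
pose tv := transverse u0 f.
have volS i : 0 < vol (y i) (y (ordS i)) by apply: vol_gt0.
have volP i : 0 < vol (y (ord_pred i)) (y i).
  by have := volS (ord_pred i); rewrite ord_predK.
have termE i : vol (y (ord_pred i)) (y (ordS i)) /
      (vol (y (ord_pred i)) (y i) * vol (y i) (y (ordS i))) =
    tv (y (ordS i)) (y i) / vol (y i) (y (ordS i)) +
    tv (y (ord_pred i)) (y i) / vol (y (ord_pred i)) (y i).
  have yP : 0 < det2 (y (ord_pred i)) (y i).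
    by have := yS (ord_pred i); rewrite ord_predK.
  have := volS i; have := volP i => v1 v2.
  by rewrite (vol_transverse u0f (py i) yP (yS i)) -/tv; field; rewrite !gt_eqF.
rewrite sumrB (eq_bigr _ (fun i _ => termE i)) big_split /=.
rewrite [X in _ - (_ + X)](reindex_inj (@ordS_inj n)) /=.
under [X in _ - (_ + X)]eq_bigr do rewrite ordSK.
have step i : h (y i) (y (ordS i)) + square_share u0 f (y i) (y (ordS i)) =
    potential u0 f (y (ordS i)) - potential u0 f (y i) + 12 * (ordS i == i0)%:R.
  rewrite (potential_step pu0 u0f) // ?(inj_eq yi) //.
  by rewrite [X in X < 0]det2C oppr_lt0.
have tot : \sum_i (h (y i) (y (ordS i)) + square_share u0 f (y i) (y (ordS i))) = 12.
  rewrite (eq_bigr _ (fun i _ => step i)) big_split sumrB /=.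
  rewrite -(reindex_inj (@ordS_inj n) (P := predT) (F := fun i => potential u0 f (y i))).
  rewrite subrr add0r -mulr_sumr.
  rewrite -(reindex_inj (@ordS_inj n) (P := predT) (F := fun i => (i == i0)%:R)).
  by rewrite (bigD1 i0) //= eqxx big1 ?addr0 ?mulr1 // => i /negPf->.
move: tot; rewrite big_split /= => tot.
have tE : \sum_i square_share u0 f (y i) (y (ordS i)) =
  \sum_i (2 / vol (y i) (y (ordS i))) -
  (\sum_i tv (y (ordS i)) (y i) / vol (y i) (y (ordS i)) +
   \sum_i tv (y i) (y (ordS i)) / vol (y i) (y (ordS i))).
  by rewrite -big_split -sumrB; apply: eq_bigr => i _; rewrite /square_share -/tv /=; ring.
by move: tot; rewrite tE; lra.
Qed.

(** * The fan *)

Section Fan.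
Variable X : complete_fan.
Implicit Types i j k : 'I_(nrays X).

(** A ray j inside the i-th cone would lie in the common face of the i-th and
the j-th cone.  It does not generate the i-th cone, so that this face could only
be spanned by the other generator of the j-th cone.  The second factors make the
condition independent of the orientation of the numbering. *)
Lemma ray_not_interior i j :
  ~~ ((0 < det2 (ray i) (ray j) * det2 (ray i) (ray (ordS i))) &&
      (0 < det2 (ray j) (ray (ordS i)) * det2 (ray i) (ray (ordS i)))).
Proof.
apply/negP=> /andP[pos1 pos2].
set u := ray i in pos1 pos2 *; set v := ray (ordS i) in pos1 pos2 *.
set x := ray j in pos1 pos2; set x' := ray (ordS j).
have d0 : det2 x x' != 0 := fan_dim2 j.
have [S [S1 S2 SE]] := fan_faces j i.
have quot (a b : int) : 0 < a * b -> 0 <= a%:~R / b%:~R :> rat.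
  move=> ab; have b0 : b != 0 by apply/eqP=> b0; rewrite b0 mulr0 ltxx in ab.
  have -> : a%:~R / b%:~R = (a * b)%:~R / b%:~R ^+ 2 :> rat.
    by rewrite rmorphM /=; field; rewrite intr_eq0.
  by rewrite divr_ge0 ?sqr_ge0 // ler0z ltW.
have : in_cone S (ratv x).
  apply/SE; split; apply/in_cone2E; rewrite ?fan_dim2 ?ray_neq // !det2_ratv.
    by rewrite divff ?intr_eq0 // det2vv mul0r.
  by split; apply: quot.
case=> c _ xE.
have onlyx' s : s \in S -> s = x'.
  move=> sS; have := S1 _ sS; have := S2 _ sS.
  rewrite !inE -/u -/v -/x -/x' => /orP[]/eqP-> /orP[]/eqP // E.
    by rewrite E det2vv mul0r ltxx in pos1.
  by rewrite E det2vv mul0r ltxx in pos2.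
have : det2 (ratv x) (ratv x') = 0.
  rewrite xE big_seq (eq_bigr (fun s => c s *: ratv x')); last first.
    by move=> s /onlyx' {2}->.
  by rewrite -scaler_suml /det2 !mxE; ring.
by rewrite det2_ratv => /eqP; rewrite intr_eq0 (negPf d0).
Qed.

Lemma orientation_const i j :
  (0 < det2 (ray i) (ray (ordS i))) = (0 < det2 (ray j) (ray (ordS j))).
Proof.
have step k : (0 < det2 (ray (ordS k)) (ray (ordS (ordS k)))) =
              (0 < det2 (ray k) (ray (ordS k))).
  have := det2_pos k; move: (det2 _ _) (det2 _ _) => a b ab.
  by apply/idP/idP; nia.
have n0 : (0 < nrays X)%N by apply: leq_trans (nrays_ge3 X).
suff base k : (0 < det2 (ray k) (ray (ordS k))) =
  (0 < det2 (ray (Ordinal n0)) (ray (ordS (Ordinal n0)))) by rewrite !base.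
case: k => k; elim: k => [|k IH] ltk.
  by rewrite (_ : Ordinal ltk = Ordinal n0) //; apply: val_inj.
have <- : ordS (Ordinal (ltnW ltk)) = Ordinal ltk.
  by apply: val_inj; rewrite /= modn_small.
by rewrite step IH.
Qed.

Lemma canonical_square :
  intersection (canonical X) (canonical X) =
  \sum_(i < nrays X) (2 / mult (ray i) (ray (ordS i)) + prime_intersection i i).
Proof.
rewrite /intersection /canonical.
have rowE i : \sum_(j < nrays X) -1 * -1 * prime_intersection i j =
    prime_intersection i i + ((mult (ray i) (ray (ordS i)))^-1 +
    (mult (ray (ord_pred i)) (ray i))^-1).
  have np : ord_pred i != i.
    by have := ordS_neq (ord_pred i); rewrite ord_predK eq_sym.
  have nps : ord_pred i != ordS i.
    by have := ordSS_neq (ord_pred i); rewrite ord_predK eq_sym.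
  rewrite (bigD1 i) //= (bigD1 (ordS i)) ?ordS_neq //=.
  rewrite (bigD1 (ord_pred i)) /= ?np ?nps // big1 => [|j]; last first.
    move=> /andP[/andP[nj njs] njp]; rewrite /prime_intersection (negPf nj) (negPf njs).
    case: eqVneq => [E|_]; last by rewrite mulr0.
    by rewrite E ordSK eqxx in njp.
  rewrite mulrNN !mulr1 !mul1r addr0; congr (_ + (_ + _)).
    by rewrite /prime_intersection (negPf (ordS_neq i)) eqxx.
  by rewrite /prime_intersection (negPf np) (negPf nps) ord_predK eqxx.
rewrite (eq_bigr _ (fun i _ => rowE i)) !big_split /= addrC; congr (_ + _).
rewrite [X in _ + X](reindex_inj (@ordS_inj _)) /= -big_split /=.
by apply: eq_bigr => i _; rewrite ordSK; ring.
Qed.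

End Fan.

(** If the rays are numbered clockwise, then the fan is replaced by its mirror
image, which has the same intersection numbers, widths and residues. *)
Theorem proposition3p3 (X : complete_fan) (n : nat) (B : seq singularity)
    (hB : singularity_content X n B) :
  intersection (canonical X) (canonical X) =
    12 - n%:R - \sum_(s <- B) contribution s.
Proof.
have [i0 _] := fan_complete X 0.
have [-> [r [a [s [ct ->]]]]] := hB.
rewrite (perm_big _ (permEl (perm_rot s _))) big_pmap big_enum natr_sum /=.
rewrite -addrA -opprD -big_split /= canonical_square.
pose phi : lattice -> lattice :=
  if 0 < det2 (ray i0) (ray (ordS i0)) then id else mirror.
pose e : int := if 0 < det2 (ray i0) (ray (ordS i0)) then 1 else -1.
have phi_prim u : primitive (phi u) = primitive u.
  by rewrite /phi; case: ifP => // _; apply: primitive_mirror.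
have phi_inj : injective phi.
  by rewrite /phi; case: ifP => _; [exact: inj_id | exact: inv_inj mirrorK].
have det_phi u v : det2 (phi u) (phi v) = e * det2 u v.
  rewrite /phi /e; case: ifP => _; first by rewrite mul1r.
  by rewrite det2_mirror det2C mulN1r.
have e2 : e * e = 1 by rewrite /e; case: ifP.
have pos (i : 'I_(nrays X)) : 0 < e * det2 (ray i) (ray (ordS i)).
  rewrite /e (orientation_const i0 i); case: ifP => [|neg]; first by rewrite mul1r.
  by rewrite mulN1r oppr_gt0 lt_neqAle fan_dim2 leNgt neg.
have hE i : (nT (ray i) (ray (ordS i)))%:R +
    oapp contribution 0 (residue (ray i) (ray (ordS i)) (a i)) =
    h (phi (ray i)) (phi (ray (ordS i))).
  rewrite -(@singularity_contribution _ _ (r i) (a i)) ?phi_prim ?ray_primitive ?det_phi //.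
    by rewrite /phi; case: ifP; rewrite ?nT_mirror ?residue_mirror.
  by rewrite /phi; case: ifP => // _; apply: cone_type_mirror.
rewrite (eq_bigr _ (fun i _ => hE i)).
rewrite -(@noether_cycle _ (fun i => phi (ray i)) i0); first last.
- move=> i; apply: contra (ray_not_interior i i0).
  rewrite !det_phi => /andP[p1 p2]; have p3 := pos i.
  have E (b c : int) : b * c = (e * b) * (e * c) by rewrite mulrACA e2 mul1r.
  by apply/andP; split; rewrite E mulr_gt0.
- by move=> i; rewrite det_phi.
- by move=> i j /phi_inj/ray_inj.
- by move=> i; rewrite phi_prim ray_primitive.
apply: eq_bigr => i _.
have := pos i; have := pos (ord_pred i); rewrite /prime_intersection eqxx ord_predK.
rewrite /mult /vol !det_phi; set u := ray _; set v := ray i; set w := ray _.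
move=> p1 p2.
have normE b : 0 < e * b -> `|b| = e * b.
  move=> p; rewrite -(gtr0_norm p) normrM.
  by rewrite [`|e|](_ : _ = 1) ?mul1r // /e; case: ifP.
rewrite !normE //; congr (_ + _).
have nz : [/\ e != 0, det2 u v != 0 & det2 v w != 0].
  split; apply/eqP=> z; [move: e2|move: p1|move: p2]; rewrite z ?mul0r ?mulr0 //.
case: nz; rewrite -(@intr_eq0 rat e) -(@intr_eq0 rat (det2 u v)) -(@intr_eq0 rat (det2 v w)).
by move=> e0 uv0 vw0; rewrite !rmorphM /=; field; rewrite e0 uv0 vw0.
Qed.
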